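(* Let $p$ be a positive integer, $k$ an integer and $n\ge1$. Expand $W_{kp}^{(n)}$ in $\{P_{-mp}\mid m\in\mathbb N\}$; then the coefficient of $P_{-m_1p}\cdot P_{-m_2p}\cdots P_{-m_ip}$ is a linear combination of operators $\bar W_{(m_1+m_2+\cdots+m_i+k)p}^{(l)}$. That is, $$W_{kp}^{(n)}=\bar W_{kp}^{(n)}+\sum_{i=1}^{n}\ \sum_{m_1,m_2,\dots,m_i\in\mathbb N}P_{-m_1p}P_{-m_2p}\cdots P_{-m_ip}\Big(\text{constant}\cdot\bar W_{(m_1+\cdots+m_i+k)p}^{(n-i)}+\text{constant}\cdot\bar W_{(m_1+\cdots+m_i+k)p}^{(n-i-1)}+\cdots+\text{constant}\cdot\bar W_{(m_1+\cdots+m_i+k)p}^{(0)}\Big),$$ where the constants (not necessarily equal to one another) only depend on $p$, and especially the constant in front of $P_{-mp}\cdot\bar W_{(m+k)p}^{(n-1)}$ (the terms with $i=1$, $m_1=m$) equals $n$.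
   Context: $\mathbb N=\{1,2,\dots\}$; $t=(t_1,t_2,\dots)$ are infinitely many variables. Let $P_i=\partial_{t_i}$ for $i>0$, $P_i=|i|\,t_{|i|}$ for $i\le0$ (so $P_0=0$), and let $:\ :$ denote normal ordering ($P_i$ with $i\le0$ to the left of those with $i>0$). Let $X(\lambda,\mu)=:\exp\sum_{i\ne0}\big(\frac{P_i}{i\lambda^i}-\frac{P_i}{i\mu^i}\big):$ and define $W_n^{(m)}$ ($m\ge0$, $n\in\mathbb Z$) by $\sum_{n\in\mathbb Z}\lambda^{-n-m}W_n^{(m)}=\partial_\mu^m|_{\mu=\lambda}X(\lambda,\mu)$; thus $W_n^{(0)}=\delta_{n,0}$, $W_n^{(1)}=P_n$, $W_n^{(2)}=\sum_{a+b=n}:P_aP_b:-(n+1)P_n$, etc. $\bar W_{kp}^{(i)}$ denotes $W_{kp}^{(i)}|_{t_{mp}=0,\ m\in\mathbb N}$, i.e. the sum of those normally ordered terms of $W_{kp}^{(i)}$ containing none of the variables $t_{mp}$, $m\in\mathbb N$. *)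

(* Defs.v *)
From mathcomp Require Export all_boot all_order all_algebra.
From mathcomp Require Export boolp classical_sets fsbigop.
From mathcomp Require Export finmap.
From mathcomp.multinomials Require Export monalg.

Set Implicit Arguments.
Unset Strict Implicit.
Unset Printing Implicit Defensive.

Export GRing.Theory Num.Theory.

Local Open Scope ring_scope.
Local Open Scope classical_set_scope.

(* A Laurent polynomial in (lambda, mu) is given by its coefficients: d a b is *)
(* the coefficient of lambda^a mu^b.                                           *)
Definition laurent2 (R : numFieldType) := int -> int -> R.

Definition laurent2_one (R : numFieldType) : laurent2 R :=
  fun a b => ((a == 0) && (b == 0))%:R.

(* d / lambda^i and d / mu^i *)
Definition laurent2_shiftl (R : numFieldType) (i : int) (d : laurent2 R) :
    laurent2 R := fun a b => d (a + i) b.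
Definition laurent2_shiftm (R : numFieldType) (i : int) (d : laurent2 R) :
    laurent2 R := fun a b => d a (b + i).

Definition laurent2_dmu (R : numFieldType) (d : laurent2 R) : laurent2 R :=
  fun a b => (b + 1)%:~R * d a (b + 1).

(* The coefficient of lambda^e in d at mu = lambda.  The sum has finite        *)
(* support when d is a Laurent polynomial.                                     *)
Definition laurent2_diag (R : numFieldType) (d : laurent2 R) (e : int) : R :=
  \sum_(a \in [set: int]) d a (e - a).

(* Formal power series in t_1, t_2, ..., given by their coefficients.  The     *)
(* variable of index j in a monomial is t_{j+1}.                               *)
Definition tseries (R : numFieldType) := {cmonom nat} -> R.

(* The operators d/dt_i and multiplication by t_i, for i > 0. *)
Definition tderiv (R : numFieldType) (i : nat) (f : tseries R) : tseries R :=
  fun M => (M i.-1).+1%:R * f (mmul M (ucm i.-1)).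
Definition tmul (R : numFieldType) (i : nat) (f : tseries R) : tseries R :=
  fun M => if (0 < M i.-1)%N then f (divcm M (ucm i.-1)) else 0.

(* The coefficient |i| makes P_0 = 0, whatever tmul 0 is. *)
Definition opP (R : numFieldType) (i : int) (f : tseries R) : tseries R :=
  if 0 < i then tderiv `|i|%N f else fun M => `|i|%N%:R * tmul `|i|%N f M.

(* The composite P_{s_1} P_{s_2} ... P_{s_j}; the last factor acts first. *)
Definition Pprod (R : numFieldType) (s : seq int) (f : tseries R) : tseries R :=
  foldr (@opP R) f s.

Definition normal_order (s : seq int) : seq int :=
  [seq i <- s | i <= 0] ++ [seq i <- s | 0 < i].

(* The product of d with 1 / (i lambda^i) - 1 / (i mu^i), the coefficient of   *)
(* P_i in the exponent of X(lambda, mu).                                       *)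
Definition mul_Xexponent (R : numFieldType) (i : int) (d : laurent2 R) :
    laurent2 R :=
  fun a b => (laurent2_shiftl i d a b - laurent2_shiftm i d a b) / i%:~R.

(* X(lambda, mu) = \sum_j :E^j: / j!, where E is the sum over i != 0 of        *)
(* (1 / (i lambda^i) - 1 / (i mu^i)) P_i.  Hence X is the sum over all finite  *)
(* sequences s = (s_1, ..., s_j) of nonzero integers of                        *)
(* Xcoef s * :P_{s_1} ... P_{s_j}:.                                            *)
Definition Xcoef (R : numFieldType) (s : seq int) : laurent2 R :=
  fun a b => foldr (@mul_Xexponent R) (@laurent2_one R) s a b / (size s)`!%:R.

(* The coefficient of lambda^(-n-m) in the m-th mu-derivative of Xcoef s at    *)
(* mu = lambda.                                                                *)
Definition Wcoef (R : numFieldType) (m : nat) (n : int) (s : seq int) : R :=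
  laurent2_diag (iter m (@laurent2_dmu R) (Xcoef R s)) (- n - m%:Z).

(* W^(m)_n is an infinite sum of normally ordered terms, but only finitely     *)
(* many of them contribute to the coefficient of a given monomial M: Wcoef     *)
(* vanishes unless s has at most m entries and these sum to n, and a term      *)
(* contributes to M only if the t_|i| coming from the negative entries i of s  *)
(* divide M.  So the finite-support sums below never take their default        *)
(* value 0.                                                                    *)
Definition W (R : numFieldType) (m : nat) (n : int) (f : tseries R) : tseries R :=
  fun M => \sum_(s \in [set s : seq int | 0 \notin s])
    Wcoef R m n s * Pprod (normal_order s) f M.

(* W^(m)_n at t_p = t_2p = ... = 0: the terms without a factor P_i such that   *)
(* i < 0 and p divides i.                                                      *)
Definition Wbar (R : numFieldType) (p : nat) (m : nat) (n : int)
    (f : tseries R) : tseries R :=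
  fun M => \sum_(s \in [set s : seq int | 0 \notin s /\
                   {in s, forall i, ~~ ((i < 0) && (p%:Z %| i)%Z)}])
    Wcoef R m n s * Pprod (normal_order s) f M.

(* Main.v *)
(* Put x = mu / lambda.  At mu = lambda, the term of W^(n)_N attached to a word  *)
(* s of sum N has coefficient (1 / |s|!) D^n (prod_i g_{s_i}) at x = 1, where    *)
(* g_i = (1 - x^(-i)) / i.  Split s into the subword s' of negative multiples of *)
(* p and the remaining subword t: there are 'C(|s|, |s'|) interleavings, which   *)
(* turns 1 / |s|! into 1 / (|s'|! |t|!), and the Leibniz rule distributes D^n    *)
(* over the two products.  The factor coming from t is a coefficient of Wbar^(l) *)
(* for l <= n - |s'|, because each g_i vanishes at x = 1.  Since g_i'(1) = 1,    *)
(* the constant for |s'| = 1 and l = n - 1 is n.                                 *)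
Require Import Defs.
From mathcomp Require Import cardinality functions.
From mathcomp Require Import ring zify.

Import Order.TTheory.

Set Implicit Arguments.
Unset Strict Implicit.
Unset Printing Implicit Defensive.

Local Open Scope ring_scope.
Local Open Scope classical_set_scope.

(** * The coefficients of X(lambda, mu) on the diagonal *)

(** Homogeneity in (lambda, mu) reduces the coefficient of a word to one variable: it vanishes
    unless the letters sum to N, and otherwise is a multiple of one Taylor coefficient at x = 1
    ([WcoefE]). It ignores the order of the letters, and multiplication operators commute, so the
    negative multiples of p can be pulled to the far left ([Pprod_normal_order]). Counting
    interleavings ([big_words_shuffle]) and multiplying Taylor polynomials ([Wcoef_cat]) then give
    [W_split]; removing letters -m_1 p, ..., -m_i p raises the prescribed sum kp of the remaining
    word to (m_1 + ... + m_i + k)p.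

    The sums are infinite, but at a fixed monomial only finitely many words matter
    ([sum_normal_order_words]), so all rearrangements take place over finite alphabets. *)

Fixpoint gbin (R : numFieldType) (x : R) (m : nat) : R :=
  if m is m'.+1 then gbin x m' * (x - m'%:R) / m%:R else 1.

Arguments gbin : simpl never.

Lemma gbinS (R : numFieldType) (x : R) m :
  m.+1%:R * gbin x m.+1 = (x - m%:R) * gbin x m.
Proof. by rewrite mulrC /gbin -/gbin divfK ?pnatr_eq0 // mulrC. Qed.

(** Vandermonde's convolution; it makes truncated expansions of powers multiply correctly, also for
    negative exponents. *)
Lemma gbinD (R : numFieldType) (x y : R) m :
  gbin (x + y) m = \sum_(l < m.+1) gbin x l * gbin y (m - l).
Proof.
elim: m => [|m IHm]; first by rewrite big_ord1 mulr1.
have m1N0 : m.+1%:R != 0 :> R by rewrite pnatr_eq0.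
apply: (mulfI m1N0); rewrite gbinS IHm [RHS]mulr_sumr.
(* Write m + 1 = l + (m + 1 - l) and lower one of the two binomials in each part by [gbinS]. *)
transitivity (\sum_(l < m.+2) l%:R * gbin x l * gbin y (m.+1 - l)%N +
              \sum_(l < m.+2) gbin x l * ((m.+1 - l)%:R * gbin y (m.+1 - l)%N));
  last first.
  rewrite -big_split; apply: eq_bigr => l _ /=.
  have -> : m.+1%:R = l%:R + (m.+1 - l)%:R :> R by rewrite -natrD subnKC // -ltnS.
  by ring.
rewrite [X in _ = X + _]big_ord_recl [X in _ = _ + X]big_ord_recr /= subnn mulr0n.
rewrite !mul0r mulr0 addr0 add0r -big_split mulr_sumr; apply: eq_bigr => l _.
have lm : (l <= m)%N by rewrite -ltnS.
have bE : bump 0 l = l.+1 by [].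
rewrite /= bE subSS gbinS (subSn lm) (gbinS y) (natrB _ lm).
by ring.
Qed.

Section LaurentSymbols.
Variable R : numFieldType.

Lemma iter_laurent2_dmu m (d : laurent2 R) a b :
  iter m (@laurent2_dmu R) d a b =
  m`!%:R * gbin (b + m%:Z)%:~R m * d a (b + m%:Z).
Proof.
elim: m a b => [|m IHm] a b; first by rewrite fact0 addr0 !mul1r.
rewrite iterS /laurent2_dmu IHm factS natrM.
have -> : b + 1 + m%:Z = b + m.+1%:Z by lia.
have := gbinS ((b + m.+1%:Z)%:~R : R) m.
have -> : (b + m.+1%:Z)%:~R - m%:R = (b + 1)%:~R :> R.
  by rewrite [m%:R]pmulrn -intrB; congr (_%:~R); lia.
move=> E; transitivity (m`!%:R * ((b + 1)%:~R * gbin (b + m.+1%:Z)%:~R m) * d a (b + m.+1%:Z)).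
  by ring.
by rewrite -E; ring.
Qed.

Definition Xproduct (s : seq int) : laurent2 R :=
  foldr (@mul_Xexponent R) (@laurent2_one R) s.

(** Finite support keeps the diagonal sums from the default value 0, so that they can be subtracted
    termwise. *)
Lemma finite_Xproduct_diag (s : seq int) c :
  finite_set [set a | Xproduct s a (c - a) != 0].
Proof.
elim: s c => [|i s IHs] c.
  apply: (@sub_finite_set _ _ [set 0]); last exact: finite_set1.
  move=> a; rewrite /= /laurent2_one; case: (a =P 0) => //= _.
  by move=> /negP; case; apply/eqP.
apply: (@sub_finite_set _ _
  ((fun a => a + i) @^-1` [set a | Xproduct s a ((c + i) - a) != 0] `|`
   [set a | Xproduct s a ((c + i) - a) != 0])); last first.
  rewrite finite_setU; split=> //; apply: finite_preimage => //.
  by move=> x y _ _ /addIr.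
move=> a /=; rewrite /mul_Xexponent /laurent2_shiftl /laurent2_shiftm.
have -> : c + i - (a + i) = c - a by lia.
have -> : c + i - a = c - a + i by lia.
rewrite -/(Xproduct s); case: (eqVneq (Xproduct s (a + i) (c - a)) 0) => [->|N0 _].
  rewrite sub0r => N0; right; apply: contraNneq N0 => ->.
  by rewrite oppr0 mul0r.
by left.
Qed.

Lemma fsumB_finite_supp (I : choiceType) (F G : I -> R) :
  finite_set [set i | F i != 0] -> finite_set [set i | G i != 0] ->
  \sum_(i \in [set: I]) (F i - G i) =
  \sum_(i \in [set: I]) F i - \sum_(i \in [set: I]) G i.
Proof.
move=> finF finG.
have finU : finite_set ([set i | F i != 0] `|` [set i | G i != 0]).
  by rewrite finite_setU.
have suppE (H : I -> R) : (forall i, F i = 0 -> G i = 0 -> H i = 0) ->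
    \sum_(i \in [set: I]) H i =
    \sum_(i \in [set i | F i != 0] `|` [set i | G i != 0]) H i.
  move=> H0; apply/esym/fsbig_widen => // i /= [_ /not_orP[/negP + /negP]].
  by rewrite !negbK => /eqP F0 /eqP G0; apply: H0.
rewrite !suppE // => [|i -> ->]; last by rewrite subr0.
rewrite !fsbig_finite //= -sumrB //.
Qed.

(* The sum of phi(b) times the coefficient of mu^b in Xproduct s. *)
Fixpoint Xeval (phi : int -> R) (s : seq int) : R :=
  if s is i :: s' then (Xeval phi s' - Xeval (fun b => phi (b - i)) s') / i%:~R
  else phi 0.

(** The factor of index i is homogeneous of degree -i, so the product lives on a single diagonal.
    The induction needs an arbitrary [phi], since dividing by mu^i shifts its argument. *)
Lemma Xproduct_diag (phi : int -> R) (s : seq int) (n : int) :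
  \sum_(a \in [set: int]) phi (- n - a) * Xproduct s a (- n - a) =
  if \sum_(i <- s) i == n then Xeval phi s else 0.
Proof.
elim: s phi n => [|i s IHs] phi n.
  rewrite big_nil (fsbigE [:: 0]) //=; last first.
    move=> a _; rewrite inE => /negPf; rewrite /laurent2_one => ->.
    by rewrite mulr0.
  rewrite big_cons big_nil addr0 in_setT /laurent2_one eqxx /= subr0.
  rewrite oppr_eq0 (eq_sym 0 n).
  by case: (n =P 0) => [->|_]; rewrite ?oppr0 ?mulr1 ?mulr0.
rewrite big_cons /=.
transitivity ((\sum_(a \in [set: int])
   (phi (- n - a) * Xproduct s (a + i) (- n - a) -
    phi (- n - a) * Xproduct s a (- n - a + i))) / i%:~R).
  rewrite mulr_fsuml; apply: eq_fsbigr => a _.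
  by rewrite /mul_Xexponent /laurent2_shiftl /laurent2_shiftm mulrA mulrBr.
have e1 a : - n - a = - (n - i) - (a + i) by lia.
have e2 a : - n - a + i = - (n - i) - a by lia.
have e3 a : - n - a = - (n - i) - a - i by lia.
rewrite fsumB_finite_supp; first last.
- apply: sub_finite_set (finite_Xproduct_diag s (- (n - i))) => a /=.
  by rewrite e2; apply: contra_neq => ->; rewrite mulr0.
- apply: (@sub_finite_set _ _ ((fun a => a + i) @^-1`
    [set a | Xproduct s a (- (n - i) - a) != 0])).
    by move=> a /=; rewrite [- n - a]e1; apply: contra_neq => ->; rewrite mulr0.
  by apply: finite_preimage (finite_Xproduct_diag _ _) => x y _ _ /addIr.
have -> : \sum_(a \in [set: int]) phi (- n - a) * Xproduct s (a + i) (- n - a) =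
   \sum_(a \in [set: int]) phi (- (n - i) - a) * Xproduct s a (- (n - i) - a).
  rewrite [RHS](@reindex_fsbigT _ _ _ _ _ (fun a => a + i)); last first.
    by exists (fun a => a - i) => a; rewrite ?addrK ?subrK.
  by apply: eq_fsbigr => a _; rewrite e1.
have -> : \sum_(a \in [set: int]) phi (- n - a) * Xproduct s a (- n - a + i) =
   \sum_(a \in [set: int]) phi (- (n - i) - a - i) * Xproduct s a (- (n - i) - a).
  by apply: eq_fsbigr => a _; rewrite e2 -e3.
rewrite (IHs phi) (IHs (fun b => phi (b - i))).
have -> : (i + \sum_(j <- s) j == n) = (\sum_(j <- s) j == n - i).
  by rewrite [i + _]addrC; rewrite -subr_eq opprK addrC eq_sym -subr_eq eq_sym.
by case: eqP; rewrite // subrr mul0r.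
Qed.

(** * Taylor polynomials at x = 1 *)

Variable N : nat.

(** The expansion of (1 + y)^x in y, truncated after degree [N]. *)
Definition binpoly (x : R) : {poly R} := \poly_(q < N.+1) gbin x q.

Definition Xfactor (i : int) : {poly R} :=
  (i%:~R)^-1 *: (1 - binpoly (- i%:~R)).

(* Taylor polynomial at x = 1, up to degree N and in the variable x - 1, of the *)
(* product of the (1 - x^(-i)) / i.                                            *)
Definition Xpoly (s : seq int) : {poly R} := \prod_(i <- s) Xfactor i.

Lemma coef_binpolyM (x : R) (q : {poly R}) m : (m <= N)%N ->
  (binpoly x * q)`_m = \sum_(l < m.+1) gbin x l * q`_(m - l).
Proof.
move=> mN; rewrite coefM; apply: eq_bigr => l _.
by rewrite coef_poly ifT // ltnS (leq_trans _ mN) // -ltnS.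
Qed.

Lemma coef_binpolyD (x y : R) (q : {poly R}) m : (m <= N)%N ->
  (binpoly (x + y) * q)`_m = (binpoly x * (binpoly y * q))`_m.
Proof.
move=> mN; rewrite mulrA !coefM; apply: eq_bigr => l _; congr (_ * _).
have lN : (l <= N)%N by rewrite (leq_trans _ mN) // -ltnS.
rewrite coef_binpolyM // coef_poly ltnS lN gbinD; apply: eq_bigr => r _.
by rewrite coef_poly ltnS (leq_trans (leq_subr _ _) lN).
Qed.

(** The parameter [z] carries the induction: shifting b by -i replaces z by z - i, that is,
    multiplies by (1 + y)^(-i). *)
Lemma Xeval_gbin (z : R) (s : seq int) m : (m <= N)%N ->
  Xeval (fun b => gbin (b%:~R + z) m) s = (binpoly z * Xpoly s)`_m.
Proof.
move=> mN; elim: s z => [|i s IHs] z.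
  by rewrite /= /Xpoly big_nil mulr1 coef_poly ltnS mN add0r.
rewrite /= /Xpoly big_cons -/(Xpoly s) IHs.
have -> : (fun b => gbin ((b - i)%:~R + z) m) =
          (fun b : int => gbin (b%:~R + (z - i%:~R)) m).
  by apply: funext => b; congr gbin; rewrite intrB; ring.
rewrite IHs coef_binpolyD // -coefB -mulrBr /Xfactor -scalerAl -scalerAr coefZ.
by rewrite mulrC mulrBl mul1r.
Qed.

Lemma binpoly0 : binpoly 0 = 1.
Proof.
apply/polyP => -[|m]; rewrite coef_poly coef1 //=.
case: ltnP => // _; elim: m => [|m IHm]; first by rewrite /gbin subrr mulr0 mul0r.
have := gbinS (0 : R) m.+1; rewrite IHm mulr0 => /eqP.
by rewrite mulf_eq0 pnatr_eq0 => /eqP.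
Qed.

(** Any truncation degree N >= m serves, so coefficients of different orders m can be read off the
    same polynomial. *)
Lemma WcoefE m n (s : seq int) : (m <= N)%N ->
  Wcoef R m n s = if \sum_(i <- s) i == n
                  then m`!%:R * (Xpoly s)`_m / (size s)`!%:R else 0.
Proof.
move=> mN; rewrite /Wcoef /laurent2_diag.
transitivity (m`!%:R / (size s)`!%:R *
  \sum_(a \in [set: int]) gbin ((- n - a)%:~R + 0) m * Xproduct s a (- n - a)).
  rewrite mulr_fsumr; apply: eq_fsbigr => a _.
  rewrite iter_laurent2_dmu addr0.
  have -> : - n - m%:Z - a + m%:Z = - n - a by lia.
  by rewrite /Xcoef -/(Xproduct s); ring.
rewrite (Xproduct_diag (fun b => gbin (b%:~R + 0) m)) Xeval_gbin //.
rewrite binpoly0 mul1r; case: ifP => _; last by rewrite mulr0.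
by ring.
Qed.

Lemma Xpoly_cat (s t : seq int) : Xpoly (s ++ t) = Xpoly s * Xpoly t.
Proof. exact: big_cat. Qed.

Lemma Xfactor_coef0 i : (Xfactor i)`_0 = 0.
Proof. by rewrite coefZ coefB coef1 coef_poly /= subrr mulr0. Qed.

(** Every factor vanishes at x = 1. Hence only words of length at most m occur in W^(m). *)
Lemma Xpoly_coef_small (s : seq int) m : (m < size s)%N -> (Xpoly s)`_m = 0.
Proof.
elim: s m => // i s IHs m ms; rewrite /Xpoly big_cons coefM.
apply: big1 => -[[|l] lm] _ /=; first by rewrite Xfactor_coef0 mul0r.
rewrite IHs ?mulr0 //; move: lm ms => /=; lia.
Qed.

Lemma Xfactor_coef1 i : (0 < N)%N -> i != 0 -> (Xfactor i)`_1 = 1.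
Proof.
move=> N0 i0; rewrite coefZ coefB coef1 coef_poly /= ltnS N0.
by rewrite /gbin mul1r subr0 divr1 sub0r opprK mulVf // intr_eq0.
Qed.

End LaurentSymbols.

(** * Sums over words *)

Fixpoint words (T : Type) (A : seq T) (j : nat) : seq (seq T) :=
  if j is j'.+1 then [seq x :: s | x <- A, s <- words A j'] else [:: [::]].

Lemma mem_words (T : eqType) (A : seq T) j s :
  (s \in words A j) = (size s == j) && all (mem A) s.
Proof.
elim: j s => [|j IHj] [|x s] //=.
  by apply/negP => /allpairsP[[y t] /= []].
rewrite eqSS; apply/allpairsP/idP => [[[y t] /= [yA]]|].
  by rewrite IHj => /andP[/eqP <- tA] [-> ->]; rewrite eqxx yA.
by move=> /and3P[sj xA sA]; exists (x, s); rewrite IHj sj.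
Qed.

Lemma words_uniq (T : eqType) (A : seq T) j : uniq A -> uniq (words A j).
Proof.
move=> uA; elim: j => //= j IHj; apply: allpairs_uniq => //.
by move=> [x s] [y t] _ _ /= [-> ->].
Qed.

Section BigWords.
Variable V : nmodType.

Lemma big_wordsS (T : Type) (A : seq T) j (F : seq T -> V) :
  \sum_(s <- words A j.+1) F s = \sum_(x <- A) \sum_(s <- words A j) F (x :: s).
Proof. exact: big_allpairs_dep. Qed.

Lemma big_words_map (T U : Type) (h : T -> U) A j (F : seq U -> V) :
  \sum_(s <- words (map h A) j) F s = \sum_(s <- words A j) F (map h s).
Proof.
elim: j F => [|j IHj] F; first by rewrite !big_seq1.
by rewrite !big_wordsS big_map; apply: eq_bigr => x _; rewrite IHj.
Qed.

(* 'C(j, i) counts the interleavings of a word of length i over A1 with a word *)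
(* of length j - i over A2.                                                    *)
Lemma big_words_shuffle (T : eqType) (a : pred T) A1 A2 j
    (F : seq T -> seq T -> V) :
  all a A1 -> all (predC a) A2 ->
  \sum_(s <- words (A1 ++ A2) j) F (filter a s) (filter (predC a) s) =
  \sum_(i < j.+1)
    (\sum_(s1 <- words A1 i) \sum_(s2 <- words A2 (j - i)) F s1 s2) *+ 'C(j, i).
Proof.
move=> /allP aA1 /allP aA2; elim: j F => [|j IHj] F.
  by rewrite big_ord1 /= !big_seq1.
pose G i k := \sum_(s1 <- words A1 i) \sum_(s2 <- words A2 k) F s1 s2.
have GE i k : \sum_(s1 <- words A1 i) \sum_(s2 <- words A2 k) F s1 s2 = G i k by [].
rewrite big_wordsS big_cat.
(* Classify words by the alphabet of their first letter; the two sums recombine by Pascal's rule. *)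
transitivity (\sum_(i < j.+1) G i.+1 (j - i)%N *+ 'C(j, i) +
              \sum_(i < j.+1) G i (j - i).+1 *+ 'C(j, i)).
  congr (_ + _).
    rewrite big_seq; under eq_bigr => x xA.
      rewrite /= aA1 //= (IHj (fun s1 s2 => F (x :: s1) s2)); over.
    rewrite -big_seq exchange_big; apply: eq_bigr => i _ /=.
    by rewrite sumrMnl /G big_wordsS.
  rewrite big_seq; under eq_bigr => x xA.
    have /negPf axF : ~~ a x by apply: (aA2 x).
    rewrite /= axF /= (IHj (fun s1 s2 => F s1 (x :: s2))); over.
  rewrite -big_seq exchange_big; apply: eq_bigr => i _ /=.
  rewrite sumrMnl /G exchange_big; congr (_ *+ _); apply: eq_bigr => s1 _.
  by rewrite big_wordsS.
under [RHS]eq_bigr do rewrite GE.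
rewrite [X in _ + X]big_ord_recl [RHS]big_ord_recl /= !subn0 !bin0 addrCA.
congr (_ + _).
under [RHS]eq_bigr => i _ do rewrite /bump /= add1n subSS binS mulrnDr.
rewrite big_split /= addrC; congr (_ + _).
rewrite [RHS]big_ord_recr /= bin_small // mulr0n addr0; apply: eq_bigr => i _.
by rewrite /bump /= add1n subnSK.
Qed.

Lemma fsum_words (T : choiceType) (A : seq T) n (P : set (seq T)) (F : seq T -> V) :
  uniq A -> (forall s, all (mem A) s -> P s) ->
  (forall s, P s -> F s != 0 -> (size s <= n)%N /\ all (mem A) s) ->
  \sum_(s \in P) F s = \sum_(j < n.+1) \sum_(s <- words A j) F s.
Proof.
move=> uA AP PF; pose r := [seq s | j <- iota 0 n.+1, s <- words A j].
have rE s : (s \in r) = (size s <= n)%N && all (mem A) s.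
  apply/allpairsPdep/andP => [[j [t [jn tA ->]]]|[sn sA]].
    by move: tA jn; rewrite mem_words mem_iota => /andP[/eqP <- ->].
  by exists (size s), s; rewrite mem_iota mem_words eqxx sA.
have ur : uniq r.
  apply: allpairs_uniq_dep; first exact: iota_uniq.
    by move=> j _; apply: words_uniq.
  move=> _ _ /allpairsPdep[j [s [_ + ->]]] /allpairsPdep[k [t [_ + ->]]] /=.
  by rewrite !mem_words => /andP[/eqP <- _] /andP[/eqP <- _] ->.
have rP : [set` r] `<=` P by move=> s /=; rewrite rE => /andP[_ /AP].
have F0 s : P s -> s \notin r -> F s = 0.
  move=> Ps; apply: contraNeq => Fs.
  by rewrite rE; case: (PF s Ps Fs) => -> ->.
rewrite (fsbigE r _ ur rP F0).
transitivity (\sum_(s <- r) F s).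
  rewrite big_seq_cond [RHS]big_seq; apply: eq_bigl => s.
  case rs: (s \in r) => //=; apply/mem_set/AP.
  by move: rs; rewrite rE => /andP[].
by rewrite big_allpairs_dep -[iota 0 _]/(index_iota 0 n.+1) big_mkord.
Qed.

Lemma fsum_tuple_words (T : choiceType) (A : seq T) i (P : set (seq T))
    (F : seq T -> V) :
  uniq A -> (forall s, all (mem A) s -> P s) ->
  (forall s, P s -> F s != 0 -> all (mem A) s) ->
  \sum_(t \in [set t : i.-tuple T | P t]) F t = \sum_(s <- words A i) F s.
Proof.
move=> uA AP PF.
transitivity (\sum_(s \in [set s | size s = i /\ P s]) F s).
  apply/esym/(reindex_fsbig (@tval i T)); split => /=.
  - by move=> t /= Pt; rewrite size_tuple.
  - by move=> s t _ _ /val_inj.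
  - by move=> s [/eqP si Ps]; exists (Tuple si).
have wP : [set` words A i] `<=` [set s | size s = i /\ P s].
  by move=> s /=; rewrite mem_words => /andP[/eqP -> /AP].
have F0 s : [set s | size s = i /\ P s] s -> s \notin words A i -> F s = 0.
  move=> [/eqP si Ps]; apply: contraNeq => Fs.
  by rewrite mem_words si (PF s).
rewrite (fsbigE _ _ (words_uniq i uA) wP F0).
rewrite big_seq_cond [RHS]big_seq; apply: eq_bigl => s.
case sA: (s \in words A i) => //=; apply/mem_set.
by move: sA; rewrite mem_words => /andP[/eqP si /AP Ps]; split.
Qed.

End BigWords.

(** * The operators P_i *)

Section Operators.
Variable R : numFieldType.
Implicit Types (F f : tseries R) (M : {cmonom nat}) (s : seq int).

Lemma Pprod_cat s t F : Pprod (s ++ t) F = Pprod s (Pprod t F).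
Proof. exact: foldr_cat. Qed.

(* Multiplication operators act on the coefficient of a single monomial by     *)
(* looking up one other coefficient, whatever the series.                      *)
Lemma Pprod_nonpos s M : all (fun i => i <= 0) s ->
  exists (K : R) (M' : {cmonom nat}),
    [/\ forall F, Pprod s F M = K * F M', forall j, (M' j <= M j)%N &
        K != 0 -> {in s, forall i : int, (0 < M `|i|%N.-1)%N}].
Proof.
elim: s M => [|i s IHs] M /=.
  by exists 1, M; split=> // F; rewrite mul1r.
move=> /andP[i0 s0]; have iF : (0 < i) = false by rewrite le_gtF.
have [Mi|Mi] := ltnP 0 (M `|i|%N.-1); last first.
  exists 0, M; split=> // [F|]; last by rewrite eqxx.
  by rewrite /opP iF /tmul ltnNge Mi mulr0 mul0r.
have [K [M' [PK M'le KM]]] := IHs (divcm M (ucm `|i|%N.-1)) s0.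
have dle j : (divcm M (ucm `|i|%N.-1) j <= M j)%N.
  by rewrite divcmE leq_subr.
exists (`|i|%N%:R * K), M'; split=> [F|j|K0 k].
- by rewrite /opP iF /tmul Mi PK mulrA.
- exact: leq_trans (M'le j) (dle j).
- rewrite inE => /predU1P[-> //|ks].
  have KN0 : K != 0 by apply: contraNneq K0 => ->; rewrite mulr0.
  exact: leq_trans (KM KN0 k ks) (dle _).
Qed.

Lemma opPC i j F : i <= 0 -> j <= 0 -> opP i (opP j F) = opP j (opP i F).
Proof.
move=> i0 j0; apply: funext => M; rewrite /opP !ltNge i0 j0 /= /tmul.
have dC : divcm (divcm M (ucm `|i|%N.-1)) (ucm `|j|%N.-1) =
          divcm (divcm M (ucm `|j|%N.-1)) (ucm `|i|%N.-1).
  by apply/eqP/cmP => k; rewrite !divcmE subnAC.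
rewrite !divcmE !ucmE dC.
case: (eqVneq `|i|%N.-1 `|j|%N.-1) => [->|_].
  by repeat case: ifP => _; rewrite ?mulr0 // mulrCA.
rewrite !subn0.
by repeat case: ifP => _; rewrite ?mulr0 // mulrCA.
Qed.

Lemma opP_Pprod i s F : i <= 0 -> all (fun j => j <= 0) s ->
  opP i (Pprod s F) = Pprod s (opP i F).
Proof.
move=> i0; elim: s => //= j s IHs /andP[j0 s0].
by rewrite opPC // IHs.
Qed.

Lemma Pprod_filter (a : pred int) s F : all (fun j => j <= 0) s ->
  Pprod s F = Pprod (filter a s) (Pprod (filter (predC a) s) F).
Proof.
elim: s => //= j s IHs /andP[j0 s0]; rewrite IHs //.
case: (a j) => //=; rewrite opP_Pprod //.
by apply/allP => i; rewrite mem_filter => /andP[_ /(allP s0)].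
Qed.

(** The letters in [a] lie in the left block of the normal ordering, where all operators commute. *)
Lemma Pprod_normal_order (a : pred int) s F : (forall i, a i -> i <= 0) ->
  Pprod (normal_order s) F =
  Pprod (filter a s) (Pprod (normal_order (filter (predC a) s)) F).
Proof.
move=> a0; rewrite /normal_order !Pprod_cat (Pprod_filter a); last first.
  by apply/allP => i; rewrite mem_filter => /andP[].
rewrite -!filter_predI; congr (Pprod _ (Pprod _ (Pprod _ _))).
- by apply: eq_filter => i /=; case ai: (a i); rewrite ?(a0 _ ai).
- by apply: eq_filter => i /=; rewrite andbC.
- apply: eq_filter => i /=; case ai: (a i); rewrite ?andbT //.
  by rewrite andbF le_gtF // a0.
Qed.

Lemma Pprod_normal_order_neq0 s f M : Pprod (normal_order s) f M != 0 ->
  {in s, forall i : int, i < 0 -> (0 < M `|i|%N.-1)%N}.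
Proof.
rewrite /normal_order Pprod_cat.
have s0 : all (fun i => i <= 0) [seq i <- s | i <= 0].
  by apply/allP => i; rewrite mem_filter => /andP[].
have [K [M' [-> _ KM]]] := Pprod_nonpos M s0.
rewrite mulf_eq0 negb_or => /andP[/KM {}KM _] i si i0; apply: KM.
by rewrite mem_filter si ltW.
Qed.

(** The other letters lower the sum by at most [B] each. This bounds the positive letters once the
    sum is prescribed. *)
Lemma mem_le_sum (B : nat) s : {in s, forall i : int, - B%:Z <= i} ->
  {in s, forall i : int, i <= \sum_(j <- s) j + (size s * B)%N%:Z}.
Proof.
have sum_ge (t : seq int) : {in t, forall i : int, - B%:Z <= i} ->
    - (size t * B)%N%:Z <= \sum_(j <- t) j.
  elim: t => [|y t IHt] tB; first by rewrite big_nil mul0n.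
  have tB' : {in t, forall i : int, - B%:Z <= i}.
    by move=> j jt; rewrite tB // inE jt orbT.
  rewrite big_cons /= mulSn; have := IHt tB'; have := tB y (mem_head _ _).
  by pose S : int := \sum_(j <- t) j; rewrite -/S; clearbody S; lia.
move=> sB i; rewrite -[_ \in _]/((i : int) \in s) => si.
rewrite (big_rem i si) (perm_size (perm_to_rem si)) /= mulSn.
have := sum_ge (rem i s) (fun j js => sB j (mem_rem js)).
by pose S : int := \sum_(j <- rem i s) j; rewrite -/S; clearbody S; lia.
Qed.

(** A contributing word has length at most m, its negative letters name variables of M, and its
    positive letters are then bounded because the sum is N. *)
Lemma sum_normal_order_words (P : set (seq int)) (A : seq int) (B C : nat)
    m n (N : int) f M :
  uniq A -> (forall s, all (mem A) s -> P s) ->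
  (forall s, P s -> {in s, forall i : int, - B%:Z <= i <= C%:Z} -> all (mem A) s) ->
  (m <= n)%N -> (forall j, (0 < M j)%N -> (j < B)%N) ->
  `|N| + (n * B)%N%:Z <= C%:Z ->
  \sum_(s \in P) Wcoef R m N s * Pprod (normal_order s) f M =
  \sum_(j < n.+1) \sum_(s <- words A j)
    Wcoef R m N s * Pprod (normal_order s) f M.
Proof.
move=> uA AP PA mn MB NC.
have supp s : P s -> Wcoef R m N s * Pprod (normal_order s) f M != 0 ->
    (size s <= n)%N /\ all (mem A) s.
  move=> Ps; rewrite mulf_eq0 negb_or (WcoefE _ _ _ (leqnn m)).
  case: (_ =P N) => [sN|_]; last by rewrite eqxx.
  move=> /andP[W0 /Pprod_normal_order_neq0 sM].
  have sn : (size s <= n)%N.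
    apply: leq_trans mn; rewrite leqNgt; apply: contraNN W0 => ms.
    by rewrite Xpoly_coef_small // mulr0 mul0r.
  have sB (i : int) : i \in s -> - B%:Z <= i.
    move=> si; have [i0|i0] := ltP i 0; last by lia.
    by have := MB _ (sM i si i0); lia.
  have sC (i : int) : i \in s -> i <= C%:Z.
    move=> /(mem_le_sum sB); rewrite sN.
    have : (size s * B <= n * B)%N by rewrite leq_mul2r sn orbT.
    by have := ler_norm N; lia.
  by split=> //; apply: PA => // i si; rewrite sB // sC.
exact: fsum_words supp.
Qed.

End Operators.

(** * Splitting off the negative multiples of p *)

Lemma sum_ord_triangle (V : nmodType) (E : nat -> nat -> V) n :
  \sum_(j < n.+1) \sum_(i < j.+1) E i (j - i)%N =
  \sum_(i < n.+1) \sum_(k < (n - i).+1) E i k.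
Proof.
elim: n => [|n IHn]; first by rewrite !big_ord1.
rewrite big_ord_recr IHn [RHS]big_ord_recr /= subnn big_ord1.
rewrite [\sum_(i < n.+2) _]big_ord_recr /= subnn addrA; congr (_ + _).
rewrite -big_split; apply: eq_bigr => i _ /=.
by rewrite subSn ?[RHS]big_ord_recr // -ltnS.
Qed.

Lemma norm_sum_le (B : nat) (s : seq int) :
  {in s, forall i : int, `|i| <= B%:Z} ->
  `|\sum_(i <- s) i| <= (size s * B)%N%:Z.
Proof.
elim: s => [|x s IHs] sB; first by rewrite big_nil normr0.
rewrite big_cons mulSn (le_trans (ler_normD _ _)) // PoszD lerD //.
  by rewrite sB // mem_head.
by apply: IHs => i si; rewrite sB // inE si orbT.
Qed.

Lemma cmonom_bounded (M : {cmonom nat}) :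
  exists B : nat, forall j, (0 < M j)%N -> (j < B)%N.
Proof.
exists (\max_(j <- finsupp M) j).+1 => j; rewrite lt0n => Mj.
by rewrite ltnS; apply: leq_bigmax_seq => //; rewrite -cmE_neq0.
Qed.

Section Splitting.
Variable R : numFieldType.
Implicit Types (f : tseries R) (M : {cmonom nat}) (s : seq int).

Lemma perm_Wcoef m N s t : perm_eq s t -> Wcoef R m N s = Wcoef R m N t.
Proof.
move=> st; rewrite !(WcoefE _ _ _ (leqnn m)) /Xpoly.
by rewrite !(perm_big _ st) (perm_size st).
Qed.

(** For l <= n this is the Leibniz weight: 'C(n, l) times the (n - l)-th derivative at x = 1 of the
    product over [s], divided by |s|!. *)
Definition split_coef n s l : R :=
  n`!%:R / (l`!%:R * (size s)`!%:R) * (Xpoly R n s)`_(n - l).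

Lemma Wcoef_cat n N s t : (size s <= n)%N ->
  Wcoef R n N (s ++ t) *+ 'C(size s + size t, size s) =
  \sum_(l < (n - size s).+1)
     split_coef n s l * Wcoef R l (N - \sum_(i <- s) i) t.
Proof.
move=> sn; rewrite (WcoefE _ _ _ (leqnn n)) big_cat /= [_ + _]addrC.
rewrite -(inj_eq (addIr (- \sum_(i <- s) i))) addrK.
have lE l : (l < (n - size s).+1)%N -> (l <= n)%N.
  by rewrite ltnS => /leq_trans; apply; apply: leq_subr.
case: ifPn => [/eqP tN|tN]; last first.
  rewrite mul0rn big1 // => l _.
  by rewrite (WcoefE _ _ _ (lE l (ltn_ord l))) (negPf tN) mulr0.
have fN0 m : m`!%:R != 0 :> R by rewrite pnatr_eq0 -lt0n fact_gt0.
transitivity (\sum_(l < (n - size s).+1) n`!%:R / ((size s)`!%:R * (size t)`!%:R) *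
    ((Xpoly R n s)`_(n - l) * (Xpoly R n t)`_l)); last first.
  apply: eq_bigr => l _; rewrite (WcoefE _ _ _ (lE l (ltn_ord l))) tN eqxx.
  by rewrite /split_coef; field; rewrite !fN0.
rewrite -mulr_sumr Xpoly_cat coefMr -mulr_natr size_cat.
have -> : (size s + size t)`!%:R =
    'C(size s + size t, size s)%:R * ((size s)`!%:R * (size t)`!%:R) :> R.
  rewrite -!natrM -(bin_fact (leq_addr (size t) (size s))).
  by rewrite [(size s + _ - _)%N]addKn.
have CN0 : 'C(size s + size t, size s)%:R != 0 :> R.
  by rewrite pnatr_eq0 -lt0n bin_gt0 leq_addr.
(* The product over [s] has a zero of order at least |s| at x = 1, which kills the terms with l > n
   - |s|. *)
have -> : \sum_(l < n.+1) (Xpoly R n s)`_(n - l) * (Xpoly R n t)`_l =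
    \sum_(l < (n - size s).+1) (Xpoly R n s)`_(n - l) * (Xpoly R n t)`_l.
  rewrite (@big_ord_widen _ _ _ (n - size s).+1 n.+1
    (fun l => (Xpoly R n s)`_(n - l) * (Xpoly R n t)`_l)); last first.
    by rewrite ltnS leq_subr.
  rewrite [RHS]big_mkcond; apply: eq_bigr => l _; case: ifPn => // lt.
  rewrite Xpoly_coef_small ?mul0r //; move: lt (ltn_ord l); lia.
by field; rewrite CN0 !fN0.
Qed.

(** * Finite alphabets and the splitting of W *)

Variables (p : nat) (hp : (0 < p)%N).

Definition negmul (i : int) : bool := (i < 0) && (p%:Z %| i)%Z.

(** Going down to -Bp instead of -B makes its words match tuples with entries in 1..B; letters below
    -B only add zero terms. *)
Definition alphabet_p (B : nat) : seq int := [seq - (j * p)%N%:Z | j <- iota 1 B].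

Definition alphabet_rest (B C : nat) : seq int :=
  [seq i <- map Negz (iota 0 B) | ~~ (p%:Z %| i)%Z] ++ map Posz (iota 1 C).

Lemma mem_alphabet_p B i :
  (i \in alphabet_p B) = negmul i && (- (B * p)%N%:Z <= i).
Proof.
apply/mapP/andP => [[j + ->]|[/andP[i0 /dvdzP[q iq]] iB]].
  rewrite mem_iota add1n ltnS => /andP[j0 jB]; rewrite /negmul.
  rewrite oppr_lt0 ltz_nat muln_gt0 j0 hp lerN2 lez_nat leq_mul2r jB orbT.
  by rewrite rpredN PoszM dvdz_mull.
have q0 : q < 0 by move: i0; rewrite iq pmulr_llt0 // ltz_nat.
exists `|q|%N; last first.
  by rewrite iq PoszM -mulNr; congr (_ * _); move: q0; lia.
rewrite mem_iota add1n ltnS; apply/andP; split; first by move: q0; lia.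
move: iB; rewrite iq PoszM -mulNr ler_pM2r ?ltz_nat // => qB.
by move: q0 qB; lia.
Qed.

Lemma mem_alphabet_rest B C i :
  (i \in alphabet_rest B C) =
  [&& i != 0, ~~ negmul i & - B%:Z <= i <= C%:Z].
Proof.
rewrite mem_cat mem_filter /negmul; case: i => [j|j].
  have /negPf-> : Posz j \notin map Negz (iota 0 B) by apply/mapP => -[].
  rewrite andbF mem_map => [|x y [] //].
  rewrite mem_iota; lia.
have /negPf-> : Negz j \notin map Posz (iota 1 C) by apply/mapP => -[].
rewrite orbF mem_map => [|x y [] //]; rewrite mem_iota add0n leq0n /=.
by case: (_ \in dvdz _) => /=; lia.
Qed.

Lemma uniq_alphabet_p B : uniq (alphabet_p B).
Proof.
rewrite map_inj_uniq ?iota_uniq // => x y /oppr_inj [/eqP].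
by rewrite eqn_pmul2r // => /eqP.
Qed.

Lemma uniq_alphabet B C : uniq (alphabet_p B ++ alphabet_rest B C).
Proof.
have uN : injective Negz by move=> x y [].
have uP : injective Posz by move=> x y [].
rewrite cat_uniq uniq_alphabet_p /alphabet_rest cat_uniq filter_uniq //=; last first.
  by rewrite map_inj_uniq // iota_uniq.
rewrite map_inj_uniq // iota_uniq andbT -/(alphabet_rest B C); apply/andP; split.
  apply/hasPn => i; rewrite mem_alphabet_rest mem_alphabet_p.
  by case: negmul; rewrite // andbF.
apply/hasPn => _ /mapP[j _ ->]; rewrite mem_filter negb_and.
by apply/orP; right; apply/mapP => -[].
Qed.

Lemma W_words n N f M (B C : nat) : (forall j, (0 < M j)%N -> (j < B)%N) ->
  `|N| + (n * B)%N%:Z <= C%:Z ->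
  W n N f M = \sum_(j < n.+1)
    \sum_(s <- words (alphabet_p B ++ alphabet_rest B C) j)
      Wcoef R n N s * Pprod (normal_order s) f M.
Proof.
move=> MB NC; apply: (@sum_normal_order_words _ _ _ B C) => //.
- exact: uniq_alphabet.
- move=> s /allP sA /=; apply/negP => /sA /=.
  by rewrite mem_cat mem_alphabet_p mem_alphabet_rest.
- move=> s /= s0 sB; apply/allP => i si; rewrite /= mem_cat.
  rewrite mem_alphabet_p mem_alphabet_rest.
  have i0 : i != 0 by apply: contraNneq s0 => <-.
  rewrite sB // i0; case: negmul => //=; rewrite orbF.
  have /andP[iB _] := sB i si; apply: le_trans iB.
  by rewrite lerN2 lez_nat leq_pmulr.
Qed.

Lemma Wbar_words m n N f M (B C : nat) : (m <= n)%N ->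
  (forall j, (0 < M j)%N -> (j < B)%N) -> `|N| + (n * B)%N%:Z <= C%:Z ->
  Wbar p m N f M = \sum_(j < n.+1) \sum_(s <- words (alphabet_rest B C) j)
      Wcoef R m N s * Pprod (normal_order s) f M.
Proof.
move=> mn MB NC; apply: (@sum_normal_order_words _ _ _ B C) => //.
- by have := uniq_alphabet B C; rewrite cat_uniq => /and3P[].
- move=> s /allP sA; split.
    by apply/negP => /sA; rewrite /= mem_alphabet_rest.
  by move=> i /sA; rewrite /= mem_alphabet_rest => /and3P[].
- move=> s [s0 sN] sB; apply/allP => i si; rewrite /= mem_alphabet_rest.
  have -> : ~~ negmul i by apply: sN.
  by rewrite sB // !andbT; apply: contraNneq s0 => <-.
Qed.

Lemma W_split n N f M (B : nat) : (forall j, (0 < M j)%N -> (j < B)%N) ->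
  W n N f M = \sum_(i < n.+1) \sum_(s <- words (alphabet_p B) i)
    Pprod s (fun M' : {cmonom nat} => \sum_(l < (n - i).+1)
       split_coef n s l * Wbar p l (N - \sum_(j <- s) j) f M') M.
Proof.
(* The middle summand absorbs the shift of [N] by the sum of [s], so one [C] serves every [Wbar]
   that appears. *)
move=> MB; pose C := (`|N| + n * (B * p) + n * B)%N.
rewrite (@W_words _ _ _ _ B C) //; last by rewrite /C; lia.
pose H s t := Wcoef R n N (s ++ t) * Pprod s (Pprod (normal_order t) f) M.
have aP : all negmul (alphabet_p B).
  by apply/allP => i; rewrite mem_alphabet_p => /andP[].
have aR : all (predC negmul) (alphabet_rest B C).
  by apply/allP => i; rewrite mem_alphabet_rest => /and3P[].
transitivity (\sum_(j < n.+1) \sum_(i < j.+1)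
  (\sum_(s <- words (alphabet_p B) i)
   \sum_(t <- words (alphabet_rest B C) (j - i)%N) H s t) *+ 'C(i + (j - i), i)).
  apply: eq_bigr => j _.
  transitivity (\sum_(s <- words (alphabet_p B ++ alphabet_rest B C) j)
      H (filter negmul s) (filter (predC negmul) s)).
    apply: eq_bigr => s _; rewrite /H (perm_Wcoef _ _ (permEl (perm_filterC negmul s))).
    by rewrite (Pprod_normal_order (a := negmul)) // => i /andP[/ltW].
  rewrite (big_words_shuffle j H aP aR); apply: eq_bigr => i _.
  by rewrite subnKC // -ltnS.
rewrite (sum_ord_triangle (fun i k => (\sum_(s <- words (alphabet_p B) i)
   \sum_(t <- words (alphabet_rest B C) k) H s t) *+ 'C(i + k, i))).
apply: eq_bigr => -[i /=]; rewrite ltnS => iN _.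
under eq_bigr do rewrite -sumrMnl; rewrite exchange_big /=.
apply: eq_big_seq => s; rewrite mem_words => /andP[/eqP si /allP sA].
have s0 : all (fun j => j <= 0) s.
  by apply/allP => j /sA; rewrite /= mem_alphabet_p => /andP[/andP[/ltW]].
(* [Pprod s] reads off a single coefficient, at a divisor M' of M; so it passes through the sums,
   and [B] still works for M'. *)
have [K [M' [PK M'M _]]] := Pprod_nonpos R M s0.
have M'B j : (0 < M' j)%N -> (j < B)%N by move=> Mj; apply: MB (leq_trans Mj (M'M j)).
have NC : `|N - \sum_(j <- s) j| + ((n - i) * B)%N%:Z <= C%:Z.
  have : `|\sum_(j <- s) j| <= (size s * (B * p))%N%:Z.
    apply: norm_sum_le => j /sA; rewrite /= mem_alphabet_p => /andP[/andP[j0 _]].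
    by rewrite ltr0_norm // lerNl.
  have le1 : (size s * (B * p) <= n * (B * p))%N by rewrite si leq_mul2r iN orbT.
  have le2 : ((n - i) * B <= n * B)%N by rewrite leq_mul2r leq_subr orbT.
  have := ler_normB N (\sum_(j <- s) j).
  move: (`|N - \sum_(j <- s) j|) (`|\sum_(j <- s) j|) => x y xle yle.
  rewrite /C !PoszD; move: le1 le2 xle yle; lia.
rewrite PK.
under [in RHS]eq_bigr => l _.
  have ln : (l <= n - i)%N by rewrite -ltnS.
  rewrite (Wbar_words f ln M'B NC) mulr_sumr; over.
rewrite exchange_big mulr_sumr; apply: eq_bigr => k _ /=.
rewrite -sumrMnl.
under [in RHS]eq_bigr do rewrite mulr_sumr; rewrite exchange_big mulr_sumr.
apply: eq_big_seq => t; rewrite mem_words => /andP[/eqP tk _].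
rewrite /H PK mulrCA -mulrnAr -mulrnAl -tk -si; congr (_ * _).
under [in RHS]eq_bigr do rewrite mulrA; rewrite -mulr_suml -Wcoef_cat ?si //.
Qed.

End Splitting.

Theorem lemma3p3 (R : numFieldType) (p n : nat) (hp : (0 < p)%N) (hn : (1 <= n)%N) :
  exists c : seq nat -> nat -> R,
    (forall (k : int) (f : tseries R) (M : {cmonom nat}),
       W n (k * p%:Z) f M =
         Wbar p n (k * p%:Z) f M +
         \sum_(1 <= i < n.+1)
           \sum_(m \in [set m : i.-tuple nat | {in m, forall j, (0 < j)%N}])
             Pprod [seq - (j * p)%N%:Z | j <- m]
               (fun M' : {cmonom nat} => \sum_(l < (n - i).+1)
                  c m l * Wbar p l (((sumn m)%:Z + k) * p%:Z) f M') M) /\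
    (forall m : nat, (0 < m)%N -> c [:: m] n.-1 = n%:R).
Proof.
(* The witness involves neither [k] nor [f] nor [M]. *)
exists (fun m l => split_coef R n [seq - (j * p)%N%:Z | j <- m] l); split.
  move=> k f M; have [B MB] := cmonom_bounded M.
  rewrite (W_split hp _ _ _ MB) -(big_mkord xpredT (fun i =>
    \sum_(s <- words (alphabet_p p B) i) Pprod s
      (fun M' : {cmonom nat} => \sum_(l < (n - i).+1) split_coef R n s l *
         Wbar p l (k * p%:Z - \sum_(j <- s) j) f M') M)).
  rewrite big_ltn //; congr (_ + _).
    (* For i = 0 the product over the empty word is 1, so only l = n survives, with constant 1. *)
    rewrite /= big_seq1 /= subn0 big_ord_recr big1 => [|l _]; last first.
      have /negPf nl : (n - l)%N != 0%N by rewrite subn_eq0 -ltnNge ltn_ord.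
      by rewrite /split_coef /Xpoly big_nil coef1 nl mulr0 mul0r.
    rewrite /= add0r big_nil subr0 /split_coef /Xpoly big_nil coef1 subnn eqxx.
    by rewrite !mulr1 divff ?mul1r // pnatr_eq0 -lt0n fact_gt0.
  apply: eq_bigr => i _; rewrite big_words_map.
  under eq_bigr => m _.
    have -> : k * p%:Z - \sum_(j <- [seq - (j * p)%N%:Z | j <- m]) j =
        ((sumn m)%:Z + k) * p%:Z.
      elim: m => [|j m IHm] /=; first by rewrite big_nil subr0 add0r.
      by rewrite big_cons opprD opprK addrCA IHm PoszM PoszD; ring.
    over.
  rewrite -(@fsum_tuple_words _ _ _ _ [set m : seq nat | {in m, forall j, (0 < j)%N}]) //=.
  - exact: iota_uniq.
  - by move=> s /allP sA j /sA; rewrite /= mem_iota => /andP[].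
  - move=> s s0 sN; apply/allP => j js; rewrite /= mem_iota s0 //= add1n.
    have sneg : all (fun i => i <= 0) [seq - (j * p)%N%:Z | j <- s].
      by apply/allP => _ /mapP[r _ ->]; rewrite oppr_le0.
    have [K [M' [PK _ KM]]] := Pprod_nonpos R M sneg.
    (* A nonzero term needs every t_{jp} in M, whence j <= jp <= B. *)
    move: sN; rewrite PK mulf_eq0 negb_or => /andP[/KM {}KM _].
    have /KM/MB : - (j * p)%N%:Z \in [seq - (j * p)%N%:Z | j <- s].
      by apply/mapP; exists j.
    have := leq_pmulr j hp; rewrite abszN absz_nat; have := s0 j js; lia.
move=> m m0; rewrite /split_coef /= /Xpoly big_seq1.
have -> : (n - n.-1)%N = 1%N by rewrite -subn1 subKn.
(* The linear Taylor coefficient of a factor is 1, leaving n! / (n - 1)! = n. *)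
rewrite Xfactor_coef1 //.
- rewrite mulr1 mulr1 -{1}(prednK hn) factS natrM mulfK ?prednK //.
  by rewrite pnatr_eq0 -lt0n fact_gt0.
- by rewrite oppr_eq0 eqz_nat -lt0n muln_gt0 m0.
Qed.
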